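(* Let $K$ be a Kripke structure and $t,t'$ states of $K$. (1) If $t$ and $t'$ are bisimilar, then $t$ and $t'$ are indistinguishable by CTL+Sync formulas without the Next operators (even when extended with sequences of unary temporal operators). (2) If $t$ and $t'$ are indistinguishable by CTL+Sync formulas without the Next operators (even when extended with sequences of unary temporal operators), then $t$ and $t'$ are stuttering bisimilar.
   Context: A Kripke structure is $K=\langle T,\Pi,\pi,R\rangle$ with $T$ a finite set of states, $\Pi$ a finite set of atomic propositions, $\pi:T\to 2^{\Pi}$ a labeling, $R\subseteq T\times T$ a transition relation; $R(t)=\{t'\mid(t,t')\in R\}$. A path is an infinite sequence $t_0t_1\dots$ with $(t_i,t_{i+1})\in R$. Two states are indistinguishable by a logic if they satisfy exactly the same formulas of that logic. Bisimilarity: $t,t'$ are bisimilar if related by a relation $B\subseteq T\times T$ such that whenever $(u,v)\in B$: $\pi(u)=\pi(v)$, every $u'\in R(u)$ has some $v'\in R(v)$ with $(u',v')\in B$, and every $v'\in R(v)$ has some $u'\in R(u)$ with $(u',v')\in B$. Stuttering bisimilarity is (equivalently) indistinguishability by CTL formulas without the Next operator, i.e. formulas built from atomic propositions, $\neg$, $\lor$, $\exists\mathcal U$ and $\forall\mathcal U$ (with the standard CTL semantics below). CTL+Sync formulas without Next: $\varphi ::= p \mid \neg\varphi_1 \mid \varphi_1\lor\varphi_2 \mid \varphi_1\,\exists\mathcal U\,\varphi_2 \mid \varphi_1\,\forall\mathcal U\,\varphi_2 \mid \varphi_1\,\mathcal U\exists\,\varphi_2 \mid \varphi_1\,\mathcal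 U\forall\,\varphi_2$, $p\in\Pi$, with semantics: standard for $p,\neg,\lor$; $\varphi_1\exists\mathcal U\varphi_2$: some path from $t$ has a $k$ with $\varphi_2$ at position $k$ and $\varphi_1$ at all positions $j<k$; $\varphi_1\forall\mathcal U\varphi_2$: every path from $t$ has such a $k$; $\varphi_1\,\mathcal U\exists\,\varphi_2$: there exists $k\ge0$ such that for all $0\le j<k$ some path $t_0t_1\dots$ from $t$ has $K,t_j\models\varphi_1$ and $K,t_k\models\varphi_2$; $\varphi_1\,\mathcal U\forall\,\varphi_2$: there exists $k\ge0$ such that for all $0\le j<k$ and all paths $t_0t_1\dots$ from $t$, $K,t_j\models\varphi_1$ and $K,t_k\models\varphi_2$. The extension with sequences of unary temporal operators adds formulas $\mathcal T Q\varphi_1$ with $\mathcal T=O_1\cdots O_m\in\{F,G\}^+$, $Q\in\{\exists,\forall\}$, where $K,t\models O_1\cdots O_m Q\varphi_1$ iff $\mathsf Q_1 k_1\ge 0\ \mathsf Q_2 k_2\ge k_1\cdots \mathsf Q_m k_m\ge k_{m-1}$ such that for $Q$ (some/all) paths $t_0t_1\dots$ with $t_0=t$, $K,t_{k_m}\models\varphi_1$, with $\mathsf Q_i$ ''there exists'' if $O_i=F$ and ''for all'' if $O_i=G$. *)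

(* Defs.v *)
From mathcomp Require Import all_boot.

Set Implicit Arguments.
Unset Strict Implicit.
Unset Printing Implicit Defensive.

(* The transition relation is not required to be total, so a state may have
   no (infinite) path at all. *)
Record kripke := Kripke {
  state : finType;
  prop : finType;
  label : state -> {set prop};
  trans : rel state
}.

Definition path_from (K : kripke) (t : state K) (p : nat -> state K) : Prop :=
  p 0 = t /\ forall i, trans (p i) (p i.+1).

Variant quantifier := Ex | All.

Definition for_paths (K : kripke) (Q : quantifier) (t : state K)
    (P : (nat -> state K) -> Prop) : Prop :=
  match Q with
  | Ex => exists p, path_from t p /\ P p
  | All => forall p, path_from t p -> P p
  end.

Variant unary_op := F | G.

(* for_positions [:: O_1; ...; O_m] k0 P unfolds to
   Q_1 k_1 >= k0, Q_2 k_2 >= k_1, ..., Q_m k_m >= k_(m-1), P k_m. *)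
Fixpoint for_positions (ops : seq unary_op) (k0 : nat) (P : nat -> Prop) : Prop :=
  match ops with
  | [::] => P k0
  | F :: ops' => exists k, k0 <= k /\ for_positions ops' k P
  | G :: ops' => forall k, k0 <= k -> for_positions ops' k P
  end.

(* Next-free formulas of CTL+Sync extended with sequences of unary operators:
     Until Ex / Until All          phi1 EU phi2 / phi1 AU phi2
     SyncUntil Ex / SyncUntil All  phi1 UE phi2 / phi1 UA phi2
     SyncSeq op ops Q              (op ops) Q phi; the head op is separate since
                                   the sequence must be nonempty. *)
Inductive formula (A : Type) :=
  | Atom of A
  | Not of formula A
  | Or of formula A & formula A
  | Until of quantifier & formula A & formula A
  | SyncUntil of quantifier & formula A & formula A
  | SyncSeq of unary_op & seq unary_op & quantifier & formula A.

(* In the SyncUntil clause the path may depend on j. The first conjunct only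
   matters for k = 0: it follows from the second one at j = 0 when k > 0, and
   without it k = 0 would make every SyncUntil formula vacuously true. *)
Fixpoint sat (K : kripke) (phi : formula (prop K)) (t : state K) : Prop :=
  match phi with
  | Atom a => a \in label t
  | Not phi1 => ~ sat phi1 t
  | Or phi1 phi2 => sat phi1 t \/ sat phi2 t
  | Until Q phi1 phi2 =>
      for_paths Q t (fun p =>
        exists k, sat phi2 (p k) /\ forall j, j < k -> sat phi1 (p j))
  | SyncUntil Q phi1 phi2 =>
      exists k,
        for_paths Q t (fun p => sat phi2 (p k)) /\
        forall j, j < k ->
          for_paths Q t (fun p => sat phi1 (p j) /\ sat phi2 (p k))
  | SyncSeq op ops Q phi1 =>
      for_positions (op :: ops) 0 (fun k =>
        for_paths Q t (fun p => sat phi1 (p k)))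
  end.

Definition ext_ctl_sync (A : Type) (phi : formula A) : bool := true.

Fixpoint ctl_sync (A : Type) (phi : formula A) : bool :=
  match phi with
  | Atom _ => true
  | Not phi1 => ctl_sync phi1
  | Or phi1 phi2 | Until _ phi1 phi2 | SyncUntil _ phi1 phi2 =>
      ctl_sync phi1 && ctl_sync phi2
  | SyncSeq _ _ _ _ => false
  end.

Fixpoint ctl (A : Type) (phi : formula A) : bool :=
  match phi with
  | Atom _ => true
  | Not phi1 => ctl phi1
  | Or phi1 phi2 | Until _ phi1 phi2 => ctl phi1 && ctl phi2
  | SyncUntil _ _ _ | SyncSeq _ _ _ _ => false
  end.

Definition indistinguishable (K : kripke) (L : pred (formula (prop K)))
    (t t' : state K) : Prop :=
  forall phi, L phi -> (sat phi t <-> sat phi t').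

Definition bisimulation (K : kripke) (B : rel (state K)) : Prop :=
  forall u v, B u v ->
    [/\ label u = label v,
        forall u', trans u u' -> exists v', trans v v' /\ B u' v'
      & forall v', trans v v' -> exists u', trans u u' /\ B u' v'].

Definition bisimilar (K : kripke) (t t' : state K) : Prop :=
  exists B : rel (state K), bisimulation B /\ B t t'.

(* Stuttering bisimilarity is taken in its logical form, indistinguishability by
   Next-free CTL, so that non-total transition relations need no convention. *)
Definition stuttering_bisimilar (K : kripke) (t t' : state K) : Prop :=
  indistinguishable (@ctl (prop K)) t t'.

(* Main.v *)
Require Import Defs.
From mathcomp Require Import all_boot.

Set Implicit Arguments.
Unset Strict Implicit.
Unset Printing Implicit Defensive.

(** A path out of one of two bisimilar states is matched, position by position,
    by a path out of the other. Hence the paths of both states realise the same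
    positionwise properties, synchronously as well as asynchronously, and
    induction on formulas gives part (1). Part (2) holds because Next-free CTL
    is a fragment of both logics. *)

Lemma bisimulation_converse (K : kripke) (B : rel (state K)) :
  bisimulation B -> bisimulation (fun u v => B v u).
Proof. by move=> bisB u v /bisB[eq_uv fwd bwd]; split. Qed.

(** The matching path is built one state at a time: forward simulation answers each transition of
    [p] while keeping the current states related. *)
Lemma path_from_bisim (K : kripke) (B : rel (state K)) (u v : state K) p :
  bisimulation B -> B u v -> path_from u p ->
  exists2 q, path_from v q & forall i, B (p i) (q i).
Proof.
move=> bisB Buv [p0 pS].
pose q := fix q i := if i is j.+1
  then odflt v [pick v' | trans (q j) v' && B (p j.+1) v'] else v.
have step i : B (p i) (q i) -> trans (q i) (q i.+1) && B (p i.+1) (q i.+1).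
  move=> Bi; rewrite /=; case: pickP => [//|none].
  have [_ fwd _] := bisB _ _ Bi.
  by have [v' [qv' Bv']] := fwd _ (pS i); have := none v'; rewrite /= qv' Bv'.
have Bpq i : B (p i) (q i).
  by elim: i => [|i /step/andP[]//]; rewrite p0.
by exists q => //; split=> // i; have /andP[] := step i (Bpq i).
Qed.

(** Keeping [P] abstract lets one transfer argument serve all the path quantifiers in [sat]. *)
Lemma for_paths_bisim (K : kripke) (B : rel (state K)) Q (u v : state K)
    (P : (nat -> state K) -> Prop) :
  bisimulation B -> B u v ->
  (forall p q, (forall i, B (p i) (q i)) -> (P p <-> P q)) ->
  for_paths Q u P <-> for_paths Q v P.
Proof.
move=> bisB Buv eqP; have bisC := bisimulation_converse bisB.
case: Q => /=; split.
- move=> [p [up Pp]]; have [q vq Bpq] := path_from_bisim bisB Buv up.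
  by exists q; split=> //; apply/(eqP p q Bpq).
(* Matching from the side of [v] through the converse yields [B (p i) (q i)], the orientation that
   [eqP] expects. *)
- move=> [q [vq Pq]].
  have [p up Bpq] := path_from_bisim (u := v) (v := u) bisC Buv vq.
  by exists p; split=> //; apply/(eqP p q Bpq).
- move=> allP q vq.
  have [p up Bpq] := path_from_bisim (u := v) (v := u) bisC Buv vq.
  by apply/(eqP p q Bpq); apply: allP.
- move=> allP p up; have [q vq Bpq] := path_from_bisim bisB Buv up.
  by apply/(eqP p q Bpq); apply: allP.
Qed.

Lemma eq_for_positions ops k0 (P P' : nat -> Prop) :
  (forall k, P k <-> P' k) ->
  for_positions ops k0 P <-> for_positions ops k0 P'.
Proof.
move=> eqP; elim: ops k0 => [|[] ops IH] k0 //=; split.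
- by move=> [k [le_k Pk]]; exists k; split=> //; apply/IH.
- by move=> [k [le_k Pk]]; exists k; split=> //; apply/IH.
- by move=> allP k le_k; apply/IH; apply: allP.
- by move=> allP k le_k; apply/IH; apply: allP.
Qed.

Lemma sat_bisim (K : kripke) (B : rel (state K)) (phi : formula (prop K)) u v :
  bisimulation B -> B u v -> sat phi u <-> sat phi v.
Proof.
(* The states stay general because the path cases use the induction hypotheses at later related
   pairs [p i], [q i]. *)
move=> bisB; elim: phi u v => [a|f IH|f IHf g IHg|Q f IHf g IHg|Q f IHf g IHg
  |op ops Q f IH] u v Buv.
- by have [eq_uv _ _] := bisB _ _ Buv; rewrite /= eq_uv.
- by have eqf := IH _ _ Buv; rewrite /=; tauto.
- by have eqf := IHf _ _ Buv; have eqg := IHg _ _ Buv; rewrite /=; tauto.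
- apply: for_paths_bisim Buv _ => // p q Bpq.
  by split=> -[k [gk fj]]; exists k;
    (split; [exact/(IHg _ _ (Bpq k)) | move=> j /fj /(IHf _ _ (Bpq j))]).
(* Here positions are chosen before paths, so paths are compared at fixed [k] and [j], and the same
   [k] serves both states. *)
- have eqk k : for_paths Q u (fun p => sat g (p k)) <->
               for_paths Q v (fun p => sat g (p k)).
    by apply: for_paths_bisim Buv _ => // p q Bpq; apply: IHg.
  have eqj j k : for_paths Q u (fun p => sat f (p j) /\ sat g (p k)) <->
                 for_paths Q v (fun p => sat f (p j) /\ sat g (p k)).
    apply: for_paths_bisim Buv _ => // p q Bpq.
    by have := IHf _ _ (Bpq j); have := IHg _ _ (Bpq k); tauto.
  by split=> -[k [gk fj]]; exists k; (split; [exact/eqk | move=> j /fj /eqj]).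
- apply: eq_for_positions => k.
  by apply: for_paths_bisim Buv _ => // p q Bpq; apply: IH.
Qed.

Lemma ctl_ctl_sync (A : Type) (phi : formula A) : ctl phi -> ctl_sync phi.
Proof. by elim: phi => //= [f IHf g IHg|_ f IHf g IHg] /andP[/IHf-> /IHg->]. Qed.

Theorem theorem5 (K : kripke) (t t' : state K) :
  (bisimilar t t' ->
     indistinguishable (@ctl_sync (prop K)) t t' /\
     indistinguishable (@ext_ctl_sync (prop K)) t t') /\
  (indistinguishable (@ctl_sync (prop K)) t t' -> stuttering_bisimilar t t') /\
  (indistinguishable (@ext_ctl_sync (prop K)) t t' -> stuttering_bisimilar t t').
Proof.
split; [|split].
- by move=> [B [bisB Btt']]; split=> phi _; apply: sat_bisim Btt'.
- by move=> indist phi /ctl_ctl_sync; apply: indist.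
- by move=> indist phi _; apply: indist.
Qed.
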